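(* Let $A$ be a ring, $M$ an $A$-module and $A(+)M$ the Nagata idealization ring of $M$. The canonical map $A\rightarrow A(+)M$ is a strong PSI-morphism if and only if $k_A(P)\otimes_A M=0$ for all $P\in \mathrm{Spec}(A)$.
   Context: All rings are commutative and unitary, and ring morphisms are unitary. The Nagata idealization $A(+)M$ is the ring with underlying additive group $A\oplus M$ and multiplication $(a,m)(a',m')=(aa',am'+a'm)$; the canonical map is $a\mapsto (a,0)$. For $P\in\mathrm{Spec}(A)$, $k_A(P)=A_P/PA_P$ denotes the residue field of $A$ at $P$. A ring morphism $A\to B$ is a strong PSI-morphism if for every $P\in\mathrm{Spec}(A)$ with $k_A(P)\otimes_A B\neq 0$, the canonical map $k_A(P)\to k_A(P)\otimes_A B$ is an isomorphism. *)

(* Defs.v *)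
From HB Require Import structures.
From mathcomp Require Import all_boot all_algebra.
From mathcomp Require Import boolp.
From mathcomp Require Import freeg.
From mathcomp Require Import ring.

Set Implicit Arguments.
Unset Strict Implicit.
Unset Printing Implicit Defensive.

Import GRing.Theory.
Local Open Scope ring_scope.
Local Open Scope quotient_scope.

(* Rings are [comPzRingType]s: commutative, unitary, possibly zero.  Subsets of
   a ring are boolean predicates as in [ring_quotient]; by the classical axioms
   of [boolp] these are arbitrary subsets. *)

(* [prime_idealr] of [ring_quotient] requires a nonzero ring. *)
Record Spec (A : comPzRingType) := MkSpec {
  prime_pred :> {pred A};
  _ : 0 \in prime_pred;
  _ : forall a, {in prime_pred &, forall u v, a * u + v \in prime_pred};
  _ : 1 \notin prime_pred;
  _ : forall u v, u * v \in prime_pred ->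
        (u \in prime_pred) || (v \in prime_pred)
}.

Section SpecTheory.
Variables (A : comPzRingType) (P : Spec A).

Lemma prime0 : 0 \in P. Proof. by case: P. Qed.
Lemma primeMD a u v : u \in P -> v \in P -> a * u + v \in P.
Proof. by case: P => p p0 h ? ?; apply: h. Qed.
Lemma prime1 : 1 \notin P. Proof. by case: P. Qed.
Lemma primeM u v : u * v \in P -> (u \in P) || (v \in P).
Proof. by case: P => p ? ? ? h /h. Qed.
Lemma primeMl a u : u \in P -> a * u \in P.
Proof. by move=> uP; rewrite -[_ * _]addr0 primeMD ?prime0. Qed.
Lemma primeD u v : u \in P -> v \in P -> u + v \in P.
Proof. by move=> uP vP; rewrite -[u]mul1r primeMD. Qed.

Definition prime_compl : {pred A} := [predC P].

Lemma prime_compl_mulr_closed : mulr_closed prime_compl.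
Proof.
split=> [|u v]; rewrite !inE ?prime1 // => uP vP.
by apply/negP => /primeM; rewrite (negPf uP) (negPf vP).
Qed.
HB.instance Definition _ :=
  GRing.isMulClosed.Build A prime_compl prime_compl_mulr_closed.

End SpecTheory.

Section Localization.
Variables (A : comPzRingType) (S : mulrClosed A).

Definition denom := {s : A | s \in S}.
Definition dval (s : denom) : A := val s.
Definition dmul (s t : denom) : denom :=
  exist _ (dval s * dval t) (rpredM (valP s) (valP t)).
Definition d1 : denom := exist _ 1 (rpred1 S).

Lemma dvalP s : dval s \in S. Proof. exact: valP. Qed.
Lemma dvalM s t : dval (dmul s t) = dval s * dval t. Proof. by []. Qed.
Lemma dval1 : dval d1 = 1. Proof. by []. Qed.
Definition dvalE := (dvalM, dval1).

Definition loc_rel (x y : A * denom) : bool :=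
  `[< exists2 u, u \in S & u * (x.1 * dval y.2 - y.1 * dval x.2) = 0 >].

Lemma loc_rel_equiv : equiv_class_of loc_rel.
Proof.
split=> [x|x y|y x z].
- by apply/asboolP; exists 1; rewrite ?rpred1 // subrr mulr0.
- by apply/asboolP/asboolP => -[u uS e]; exists u => //;
    rewrite -opprB mulrN e oppr0.
move=> /asboolP[u uS eu] /asboolP[v vS ev]; apply/asboolP.
exists (u * v * dval y.2); first by rewrite !rpredM // (dvalP y.2).
transitivity (v * dval z.2 * (u * (x.1 * dval y.2 - y.1 * dval x.2)) +
              u * dval x.2 * (v * (y.1 * dval z.2 - z.1 * dval y.2))).
  by ring.
by rewrite eu ev !mulr0 addr0.
Qed.

Canonical loc_rel_equivrel := EquivRelPack loc_rel_equiv.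
Canonical loc_rel_encmod := defaultEncModRel loc_rel.

Definition localization := {eq_quot loc_rel}.
HB.instance Definition _ : EqQuotient _ loc_rel localization :=
  EqQuotient.on localization.
HB.instance Definition _ := Choice.on localization.

Definition frac (a : A) (s : denom) : localization := \pi_localization (a, s).

Lemma fracP a s b t :
  frac a s = frac b t <-> exists2 u, u \in S & u * (a * dval t - b * dval s) = 0.
Proof.
split=> [/eqP|h]; first by rewrite /frac piE => /asboolP.
by apply/eqP; rewrite /frac piE; apply/asboolP.
Qed.

Lemma fracW (Q : localization -> Prop) :
  (forall a s, Q (frac a s)) -> forall x, Q x.
Proof. by move=> h; elim/quotW => -[a s]; apply: h. Qed.

Definition lnum (x : localization) := (repr x).1.
Definition lden (x : localization) := (repr x).2.

Lemma frac_repr x : frac (lnum x) (lden x) = x.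
Proof. by rewrite /frac -surjective_pairing reprK. Qed.

Definition ladd x y :=
  frac (lnum x * dval (lden y) + lnum y * dval (lden x)) (dmul (lden x) (lden y)).
Definition lopp x := frac (- lnum x) (lden x).
Definition lmul x y := frac (lnum x * lnum y) (dmul (lden x) (lden y)).

Lemma lden_rel a s : exists2 u, u \in S &
  u * (lnum (frac a s) * dval s) = u * (a * dval (lden (frac a s))).
Proof.
have /fracP[u uS /eqP] := frac_repr (frac a s).
by rewrite mulrBr subr_eq0 => /eqP; exists u.
Qed.

Lemma laddE a s b t :
  ladd (frac a s) (frac b t) = frac (a * dval t + b * dval s) (dmul s t).
Proof.
have [u uS eu] := lden_rel a s; have [v vS ev] := lden_rel b t.
rewrite /ladd; move: (lnum _) (lden _) eu (lnum _) (lden _) ev.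
move=> a' s' eu b' t' ev; apply/fracP.
exists (u * v); rewrite ?rpredM // !dvalE.
transitivity (v * dval t' * dval t * (u * (a' * dval s) - u * (a * dval s')) +
              u * dval s' * dval s * (v * (b' * dval t) - v * (b * dval t'))).
  by ring.
by rewrite eu ev !subrr !mulr0 addr0.
Qed.

Lemma loppE a s : lopp (frac a s) = frac (- a) s.
Proof.
have [u uS eu] := lden_rel a s; rewrite /lopp.
move: (lnum _) (lden _) eu => a' s' eu; apply/fracP; exists u => //.
transitivity (u * (a * dval s') - u * (a' * dval s)); first by ring.
by rewrite eu subrr.
Qed.

Lemma lmulE a s b t :
  lmul (frac a s) (frac b t) = frac (a * b) (dmul s t).
Proof.
have [u uS eu] := lden_rel a s; have [v vS ev] := lden_rel b t.
rewrite /lmul; move: (lnum _) (lden _) eu (lnum _) (lden _) ev.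
move=> a' s' eu b' t' ev; apply/fracP.
exists (u * v); rewrite ?rpredM // !dvalE.
transitivity ((u * (a' * dval s)) * (v * (b' * dval t))
            - (u * (a * dval s')) * (v * (b * dval t'))); first by ring.
by rewrite eu ev subrr.
Qed.

Lemma frac_eq a s b t : a * dval t = b * dval s -> frac a s = frac b t.
Proof. by move=> e; apply/fracP; exists 1; rewrite ?rpred1 // e subrr mulr0. Qed.

Lemma laddA : associative ladd.
Proof.
elim/fracW=> a s; elim/fracW=> b t; elim/fracW=> c u.
by rewrite !laddE; apply: frac_eq; rewrite !dvalE; ring.
Qed.
Lemma laddC : commutative ladd.
Proof.
elim/fracW=> a s; elim/fracW=> b t.
by rewrite !laddE; apply: frac_eq; rewrite !dvalE; ring.
Qed.
Lemma ladd0 : left_id (frac 0 d1) ladd.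
Proof. by elim/fracW=> a s; rewrite laddE; apply: frac_eq; rewrite !dvalE; ring. Qed.
Lemma laddN : left_inverse (frac 0 d1) lopp ladd.
Proof. by elim/fracW=> a s; rewrite loppE laddE; apply: frac_eq; rewrite !dvalE; ring. Qed.
HB.instance Definition _ :=
  GRing.isZmodule.Build localization laddA laddC ladd0 laddN.

Lemma lmulA : associative lmul.
Proof.
elim/fracW=> a s; elim/fracW=> b t; elim/fracW=> c u.
by rewrite !lmulE; apply: frac_eq; rewrite !dvalE; ring.
Qed.
Lemma lmulC : commutative lmul.
Proof.
elim/fracW=> a s; elim/fracW=> b t.
by rewrite !lmulE; apply: frac_eq; rewrite !dvalE; ring.
Qed.
Lemma lmul1 : left_id (frac 1 d1) lmul.
Proof. by elim/fracW=> a s; rewrite lmulE; apply: frac_eq; rewrite !dvalE; ring. Qed.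
Lemma lmulDl : left_distributive lmul ladd.
Proof.
elim/fracW=> a s; elim/fracW=> b t; elim/fracW=> c u.
by rewrite laddE !lmulE laddE; apply: frac_eq; rewrite !dvalE; ring.
Qed.
HB.instance Definition _ :=
  GRing.Zmodule_isComPzRing.Build localization lmulA lmulC lmul1 lmulDl.

Lemma fracD a s b t : frac a s + frac b t = frac (a * dval t + b * dval s) (dmul s t).
Proof. exact: laddE. Qed.
Lemma fracN a s : - frac a s = frac (- a) s.
Proof. exact: loppE. Qed.
Lemma fracM a s b t : frac a s * frac b t = frac (a * b) (dmul s t).
Proof. exact: lmulE. Qed.

Definition to_loc (a : A) : localization := frac a d1.

Lemma to_loc_zmod_morphism : zmod_morphism to_loc.
Proof.
by move=> a b; rewrite /to_loc fracN fracD; apply: frac_eq; rewrite !dvalE; ring.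
Qed.
Lemma to_loc_monoid_morphism : monoid_morphism to_loc.
Proof.
by split=> // a b; rewrite /to_loc fracM; apply: frac_eq; rewrite !dvalE; ring.
Qed.
HB.instance Definition _ :=
  GRing.isZmodMorphism.Build A localization to_loc to_loc_zmod_morphism.
HB.instance Definition _ :=
  GRing.isMonoidMorphism.Build A localization to_loc to_loc_monoid_morphism.

End Localization.

(* The ideal of R generated by f(I). *)
Definition ext_ideal (A R : comPzRingType) (f : A -> R) (I : {pred A}) :
    {pred R} :=
  fun x => `[< exists n (c : 'I_n -> R) (p : 'I_n -> A),
                 (forall i, p i \in I) /\ x = \sum_i c i * f (p i) >].

Section ResidueField.
Variables (A : comPzRingType) (P : Spec A).

Definition local_at := localization (prime_compl P).
HB.instance Definition _ := GRing.ComPzRing.on local_at.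

Definition to_local : A -> local_at := @to_loc A (prime_compl P).
HB.instance Definition _ :=
  GRing.RMorphism.copy to_local (@to_loc A (prime_compl P)).

Lemma local_at_nonzero : (1 : local_at) != 0.
Proof.
apply/eqP => /fracP[u]; rewrite inE /= => uP.
by rewrite mulr1 mul0r subr0 mulr1 => u0; rewrite u0 prime0 in uP.
Qed.
HB.instance Definition _ := GRing.PzSemiRing_isNonZero.Build local_at
  local_at_nonzero.

Definition max_ideal : {pred local_at} := ext_ideal to_local P.

Lemma max_idealP (x : local_at) :
  x \in max_ideal <-> exists2 p, p \in P & exists s, x = frac p s.
Proof.
split=> [/asboolP[n [c [p [pP ->]]]]|[p pP [s ->]]]; last first.
  apply/asboolP; exists 1%N, (fun=> frac 1 s), (fun=> p); split=> //.
  rewrite big_ord1 [RHS]fracM; apply: frac_eq; rewrite !dvalE; ring.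
elim/big_ind: _ => [|y z [p1 p1P [s ->]] [p2 p2P [t ->]]|i _].
- by exists 0; [exact: prime0 | exists (d1 _)].
- rewrite fracD; eexists; last by eexists.
  by apply: primeD; rewrite mulrC primeMl.
elim/fracW: (c i) => b t; rewrite [_ * _]fracM.
by exists (b * p i); [rewrite primeMl | eexists].
Qed.

Lemma max_ideal_idealr_closed : idealr_closed max_ideal.
Proof.
split.
- by apply/max_idealP; exists 0; [exact: prime0 | exists (d1 _)].
- apply/negP => /max_idealP[p pP [s /fracP[u]]]; rewrite inE /= => uP /eqP.
  rewrite mul1r mulr1 mulrBr subr_eq0 => /eqP e.
  have /primeM : u * dval s \in P by rewrite e primeMl.
  by rewrite (negPf uP) /=; apply/negP; exact: (dvalP s).
move=> a x y /max_idealP[p pP [s ->]] /max_idealP[q qP [t ->]].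
elim/fracW: a => b r; apply/max_idealP; rewrite [_ * _]fracM [_ + _]fracD.
eexists; last by eexists.
by apply: primeD; rewrite mulrC !primeMl.
Qed.
HB.instance Definition _ :=
  isIdealr.Build local_at max_ideal max_ideal_idealr_closed.

Definition residue_field := {ideal_quot max_ideal}.
HB.instance Definition _ := GRing.ComNzRing.on residue_field.

Definition to_residue : A -> residue_field :=
  fun a => \pi_residue_field (to_local a).

Lemma to_residue_zmod_morphism : zmod_morphism to_residue.
Proof. by move=> a b; rewrite /to_residue !rmorphB. Qed.
Lemma to_residue_monoid_morphism : monoid_morphism to_residue.
Proof.
by split=> [|a b]; rewrite /to_residue ?rmorph1 // !rmorphM.
Qed.
HB.instance Definition _ :=
  GRing.isZmodMorphism.Build A residue_field to_residue to_residue_zmod_morphism.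
HB.instance Definition _ :=
  GRing.isMonoidMorphism.Build A residue_field to_residue
    to_residue_monoid_morphism.

Lemma residue_field_invertible (x : residue_field) :
  x != 0 -> exists y, y * x = 1.
Proof.
elim/quotW: x; elim/fracW=> a s x0.
have aP : a \in prime_compl P.
  rewrite inE /=; apply: contraNN x0 => aP.
  rewrite -(rmorph0 \pi_residue_field) -Quotient.idealrBE subr0.
  by apply/max_idealP; exists a => //; exists s.
exists (\pi_residue_field (frac (dval s) (exist _ a aP : denom _))).
rewrite -rmorphM -(rmorph1 \pi_residue_field); congr (\pi _).
by rewrite [LHS]fracM; apply: frac_eq; rewrite !dvalE /dval /=; ring.
Qed.

Definition residue_inv (x : residue_field) : residue_field :=
  if pselect (exists y, y * x = 1) is left h then projT1 (cid h) else 0.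

Lemma residue_mulVf x : x != 0 -> residue_inv x * x = 1.
Proof.
move=> /residue_field_invertible h; rewrite /residue_inv.
by case: pselect => // h'; case: cid.
Qed.
Lemma residue_invr0 : residue_inv 0 = 0.
Proof.
rewrite /residue_inv; case: pselect => // h; case: cid => y /= /eqP.
by rewrite mulr0 eq_sym oner_eq0.
Qed.
HB.instance Definition _ :=
  GRing.ComNzRing_isField.Build residue_field residue_mulVf residue_invr0.

End ResidueField.

Section Tensor.
Variables (A : comPzRingType) (M N : lmodType A).

(* The subgroup of the free abelian group on M * N generated by the relations
   of biadditivity and A-balancedness. *)
Inductive tensor_rel : {freeg (M * N)%type} -> Prop :=
| tensor_rel0 : tensor_rel 0
| tensor_relB x y : tensor_rel x -> tensor_rel y -> tensor_rel (x - y)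
| tensor_rel_addl m m' n :
    tensor_rel (<<(m + m', n)>> - <<(m, n)>> - <<(m', n)>>)
| tensor_rel_addr m n n' :
    tensor_rel (<<(m, n + n')>> - <<(m, n)>> - <<(m, n')>>)
| tensor_rel_bal a m n :
    tensor_rel (<<(a *: m, n)>> - <<(m, a *: n)>>).

Definition tensor_relb : {pred {freeg (M * N)%type}} :=
  fun x => `[< tensor_rel x >].

Lemma tensor_relb_closed : zmod_closed tensor_relb.
Proof.
split=> [|x y /asboolP xR /asboolP yR]; apply/asboolP.
  exact: tensor_rel0.
exact: tensor_relB.
Qed.
HB.instance Definition _ :=
  GRing.isZmodClosed.Build {freeg (M * N)%type} tensor_relb tensor_relb_closed.

Definition tensor := Quotient.quot tensor_relb.
HB.instance Definition _ := GRing.Zmodule.on tensor.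

Definition tens (m : M) (n : N) : tensor := \pi_tensor <<(m, n)>>.

Lemma tensor_eq x y : tensor_rel (x - y) -> \pi_tensor x = \pi_tensor y.
Proof.
by move=> h; apply/eqP; rewrite -Quotient.idealrBE; apply/asboolP.
Qed.

Lemma tensDl m m' n : tens (m + m') n = tens m n + tens m' n.
Proof.
rewrite /tens -raddfD; apply: tensor_eq; rewrite opprD addrA.
exact: tensor_rel_addl.
Qed.
Lemma tensDr m n n' : tens m (n + n') = tens m n + tens m n'.
Proof.
rewrite /tens -raddfD; apply: tensor_eq; rewrite opprD addrA.
exact: tensor_rel_addr.
Qed.
Lemma tens_bal a m n : tens (a *: m) n = tens m (a *: n).
Proof. by apply: tensor_eq; exact: tensor_rel_bal. Qed.
Lemma tens0l n : tens 0 n = 0.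
Proof. by apply: (addrI (tens 0 n)); rewrite -tensDl !addr0. Qed.
Lemma tensNl m n : tens (- m) n = - tens m n.
Proof. by apply/eqP; rewrite -addr_eq0 -tensDl addNr tens0l. Qed.

Lemma tensor_ind (Q : tensor -> Prop) :
  Q 0 -> (forall x y, Q x -> Q y -> Q (x + y)) -> (forall m n, Q (tens m n)) ->
  forall x, Q x.
Proof.
move=> Q0 QD Qt; elim/quotW=> x; rewrite -(freeg_sumE x).
rewrite raddf_sum; elim/big_ind: _ => // -[m n] _.
rewrite -[coeff _ _]mul1r -[_ * _]mulrzz -freeg_mulz raddfMz -/(tens m n).
suff h (k : nat) m' : Q (tens m' n *+ k).
  rewrite [coeff _ _]intEsign; case: (coeff _ _ < 0).
    by rewrite mulN1r mulrNz -mulNrz -tensNl; exact: h.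
  by rewrite mul1r; exact: h.
elim: k => [|k IHk]; first by rewrite mulr0n.
by rewrite mulrS; apply: QD.
Qed.

Section Lift.
Variables (V : zmodType) (h : M -> N -> V).

Let hf : {freeg (M * N)%type} -> zmodule V :=
  fglift (fun p : M * N => h p.1 p.2 : zmodule V).

(* The additive map on the tensor product induced by [h], when [h] is
   biadditive and A-balanced. *)
Definition tensor_lift (x : tensor) : V := hf (repr x).

Hypothesis hDl : forall m m' n, h (m + m') n = h m n + h m' n.
Hypothesis hDr : forall m n n', h m (n + n') = h m n + h m n'.
Hypothesis hbal : forall a m n, h (a *: m) n = h m (a *: n).

Let hfB x y : hf (x - y) = hf x - hf y.
Proof. exact: (lift_is_additive (M := zmodule V)). Qed.

Let hf1 m n : hf <<(m, n)>> = h m n.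
Proof. by rewrite /hf liftU scale1r. Qed.

Let hf_rel x : tensor_rel x -> hf x = 0.
Proof.
elim=> [|{}x y _ hx _ hy|m m' n|m n n'|a m n].
- by rewrite -(subrr 0) hfB subrr.
- by rewrite hfB hx hy subrr.
- by rewrite !hfB !hf1 hDl addrAC addrK subrr.
- by rewrite !hfB !hf1 hDr addrAC addrK subrr.
- by rewrite hfB !hf1 hbal subrr.
Qed.

Let hf_pi x : tensor_lift (\pi_tensor x) = hf x.
Proof.
have /asboolP/hf_rel : repr (\pi_tensor x) - x \in tensor_relb.
  by rewrite Quotient.idealrBE reprK.
by rewrite hfB => /eqP; rewrite subr_eq0 => /eqP.
Qed.

Lemma tensor_lift_tens m n : tensor_lift (tens m n) = h m n.
Proof. by rewrite hf_pi hf1. Qed.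

Lemma tensor_liftD x y : tensor_lift (x + y) = tensor_lift x + tensor_lift y.
Proof.
have hfD u v : hf (u + v) = hf u + hf v.
  by rewrite -{2}[u](addrK v) hfB subrK.
by elim/quotW: x; elim/quotW: y => u v; rewrite -raddfD !hf_pi hfD.
Qed.

Lemma tensor_lift0 : tensor_lift 0 = 0.
Proof. by apply: (addrI (tensor_lift 0)); rewrite -tensor_liftD !addr0. Qed.

End Lift.

Definition tensor_scale a : tensor -> tensor :=
  tensor_lift (fun m n => tens (a *: m) n).

Lemma tensor_scale_tens a m n : tensor_scale a (tens m n) = tens (a *: m) n.
Proof.
apply: tensor_lift_tens => [{}m m' {}n|{}m {}n n'|b {}m {}n].
- by rewrite scalerDr tensDl.
- by rewrite tensDr.
- by rewrite scalerA mulrC -scalerA tens_bal.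
Qed.

Lemma tensor_scaleDr a : {morph tensor_scale a : x y / x + y}.
Proof.
apply: tensor_liftD => [m m' n|m n n'|b m n].
- by rewrite scalerDr tensDl.
- by rewrite tensDr.
- by rewrite scalerA mulrC -scalerA tens_bal.
Qed.

Lemma tensor_scale0 a : tensor_scale a 0 = 0.
Proof. by apply: (addrI (tensor_scale a 0)); rewrite -tensor_scaleDr !addr0. Qed.

Lemma tensor_scaleA a b x :
  tensor_scale a (tensor_scale b x) = tensor_scale (a * b) x.
Proof.
elim/tensor_ind: x => [|x y hx hy|m n]; first by rewrite !tensor_scale0.
  by rewrite !tensor_scaleDr hx hy.
by rewrite !tensor_scale_tens scalerA.
Qed.

Lemma tensor_scale1 : left_id 1 tensor_scale.
Proof.
elim/tensor_ind => [|x y hx hy|m n]; first by rewrite tensor_scale0.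
  by rewrite tensor_scaleDr hx hy.
by rewrite tensor_scale_tens scale1r.
Qed.

Lemma tensor_scaleDl x : {morph tensor_scale^~ x : a b / a + b}.
Proof.
move=> a b; elim/tensor_ind: x => [|x y hx hy|m n].
- by rewrite !tensor_scale0 addr0.
- by rewrite !tensor_scaleDr hx hy addrACA.
by rewrite !tensor_scale_tens scalerDl tensDl.
Qed.

HB.instance Definition _ := GRing.Zmodule_isLmodule.Build A tensor
  tensor_scaleA tensor_scale1 tensor_scaleDr tensor_scaleDl.

Lemma tensZ a m n : a *: tens m n = tens (a *: m) n.
Proof. exact: tensor_scale_tens. Qed.

End Tensor.

(* R viewed as an A-module through f. *)
Definition restr (A R : comPzRingType) (f : {rmorphism A -> R}) : Type := R.

Section Restr.
Variables (A R : comPzRingType) (f : {rmorphism A -> R}).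
HB.instance Definition _ := GRing.ComPzRing.copy (restr f) R.

Definition restr_scale (a : A) (x : restr f) : restr f := f a * (x : R).

Lemma restr_scaleA a b x : restr_scale a (restr_scale b x) = restr_scale (a * b) x.
Proof. by rewrite /restr_scale rmorphM mulrA. Qed.
Lemma restr_scale1 : left_id 1 restr_scale.
Proof. by move=> x; rewrite /restr_scale rmorph1 mul1r. Qed.
Lemma restr_scaleDr : right_distributive restr_scale +%R.
Proof. by move=> a x y; rewrite /restr_scale mulrDr. Qed.
Lemma restr_scaleDl x : {morph restr_scale^~ x : a b / a + b}.
Proof. by move=> a b; rewrite /restr_scale rmorphD mulrDl. Qed.
HB.instance Definition _ := GRing.Zmodule_isLmodule.Build A (restr f)
  restr_scaleA restr_scale1 restr_scaleDr restr_scaleDl.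

Lemma restrZE a (x : restr f) : a *: x = f a * (x : R). Proof. by []. Qed.
Lemma restrZl a (x y : restr f) : (a *: x) * y = a *: (x * y).
Proof. by rewrite !restrZE [RHS]mulrA. Qed.
Lemma restrZr a (x y : restr f) : x * (a *: y) = a *: (x * y).
Proof. by rewrite mulrC restrZl mulrC. Qed.
End Restr.

(* The ring R ⊗_A S, for f : A -> R and g : A -> S. *)
Definition rtensor (A R S : comPzRingType)
  (f : {rmorphism A -> R}) (g : {rmorphism A -> S}) : Type :=
  tensor (restr f) (restr g).

Section RTensor.
Variables (A R S : comPzRingType).
Variables (f : {rmorphism A -> R}) (g : {rmorphism A -> S}).
Local Notation T := (rtensor f g).
HB.instance Definition _ := GRing.Lmodule.on T.

Definition rtens (r : R) (s : S) : T := tens (r : restr f) (s : restr g).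

(* Multiplication by r ⊗ s. *)
Let tmul (r : restr f) (s : restr g) : T -> T :=
  tensor_lift (fun r' s' => tens (r * r') (s * s')).

(* (r ⊗ s) (r' ⊗ s') = r r' ⊗ s s'. *)
Definition rtensor_mul (x y : T) : T := tensor_lift (fun r s => tmul r s y) x.

Let tmulD r s : {morph tmul r s : x y / x + y}.
Proof.
apply: tensor_liftD => [m m' n|m n n'|b m n].
- by rewrite mulrDr tensDl.
- by rewrite mulrDr tensDr.
- by rewrite !restrZr tens_bal.
Qed.

Let tmulE r s r' s' : tmul r s (tens r' s') = tens (r * r') (s * s').
Proof.
apply: tensor_lift_tens => [m m' n|m n n'|b m n].
- by rewrite mulrDr tensDl.
- by rewrite mulrDr tensDr.
- by rewrite !restrZr tens_bal.
Qed.

Let tmul0 r s : tmul r s 0 = 0.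
Proof. by apply: (addrI (tmul r s 0)); rewrite -tmulD !addr0. Qed.

Let tmulDl r r' s x : tmul (r + r') s x = tmul r s x + tmul r' s x.
Proof.
elim/tensor_ind: x => [|x y hx hy|m n]; first by rewrite !tmul0 addr0.
  by rewrite !tmulD hx hy addrACA.
by rewrite !tmulE mulrDl tensDl.
Qed.
Let tmulDr r s s' x : tmul r (s + s') x = tmul r s x + tmul r s' x.
Proof.
elim/tensor_ind: x => [|x y hx hy|m n]; first by rewrite !tmul0 addr0.
  by rewrite !tmulD hx hy addrACA.
by rewrite !tmulE mulrDl tensDr.
Qed.
Let tmulbal a r s x : tmul (a *: r) s x = tmul r (a *: s) x.
Proof.
elim/tensor_ind: x => [|x y hx hy|m n]; first by rewrite !tmul0.
  by rewrite !tmulD hx hy.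
by rewrite !tmulE !restrZl tens_bal.
Qed.

Lemma rtensor_mulE r s r' s' :
  rtensor_mul (tens r s) (tens r' s') = tens (r * r') (s * s').
Proof. by rewrite /rtensor_mul tensor_lift_tens ?tmulE. Qed.

Lemma rtensor_mulDl : left_distributive rtensor_mul +%R.
Proof. by move=> x y z; apply: tensor_liftD. Qed.

Lemma rtensor_mul0l x : rtensor_mul 0 x = 0.
Proof. by apply: tensor_lift0. Qed.

Lemma rtensor_mulDr : right_distributive rtensor_mul +%R.
Proof.
move=> x y z; elim/tensor_ind: x => [|x x' hx hx'|r s].
- by rewrite !rtensor_mul0l addr0.
- by rewrite !rtensor_mulDl hx hx' addrACA.
by rewrite /rtensor_mul !tensor_lift_tens // tmulD.
Qed.

Lemma rtensor_mul0r x : rtensor_mul x 0 = 0.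
Proof. by apply: (addrI (rtensor_mul x 0)); rewrite -rtensor_mulDr !addr0. Qed.

Lemma rtensor_mulC : commutative rtensor_mul.
Proof.
move=> x y; elim/tensor_ind: x => [|x x' hx hx'|r s].
- by rewrite rtensor_mul0l rtensor_mul0r.
- by rewrite rtensor_mulDl rtensor_mulDr hx hx'.
elim/tensor_ind: y => [|y y' hy hy'|r' s'].
- by rewrite rtensor_mul0l rtensor_mul0r.
- by rewrite rtensor_mulDl rtensor_mulDr hy hy'.
by rewrite !rtensor_mulE mulrC [s * _]mulrC.
Qed.

Lemma rtensor_mulA : associative rtensor_mul.
Proof.
move=> x y z; elim/tensor_ind: x => [|x x' hx hx'|r s].
- by rewrite !rtensor_mul0l.
- by rewrite !rtensor_mulDl hx hx'.
elim/tensor_ind: y => [|y y' hy hy'|r' s'].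
- by rewrite rtensor_mul0r !rtensor_mul0l rtensor_mul0r.
- by rewrite rtensor_mulDl !rtensor_mulDr hy hy' rtensor_mulDl.
elim/tensor_ind: z => [|z z' hz hz'|r'' s''].
- by rewrite !rtensor_mul0r.
- by rewrite !rtensor_mulDr hz hz'.
by rewrite !rtensor_mulE !mulrA.
Qed.

Lemma rtensor_mul1 : left_id (rtens 1 1) rtensor_mul.
Proof.
elim/tensor_ind => [|x y hx hy|m n]; first by rewrite rtensor_mul0r.
  by rewrite rtensor_mulDr hx hy.
by rewrite /rtens rtensor_mulE !mul1r.
Qed.

HB.instance Definition _ := GRing.Zmodule_isComPzRing.Build T
  rtensor_mulA rtensor_mulC rtensor_mul1 rtensor_mulDl.

Lemma rtensM r s r' s' : rtens r s * rtens r' s' = rtens (r * r') (s * s').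
Proof. exact: rtensor_mulE. Qed.

Definition rtensor_inl (r : R) : T := rtens r 1.

Lemma rtensor_inl_zmod_morphism : zmod_morphism rtensor_inl.
Proof. by move=> x y; rewrite /rtensor_inl /rtens tensDl tensNl. Qed.
Lemma rtensor_inl_monoid_morphism : monoid_morphism rtensor_inl.
Proof. by split=> // x y; rewrite /rtensor_inl rtensM mulr1. Qed.
HB.instance Definition _ :=
  GRing.isZmodMorphism.Build R T rtensor_inl rtensor_inl_zmod_morphism.
HB.instance Definition _ :=
  GRing.isMonoidMorphism.Build R T rtensor_inl rtensor_inl_monoid_morphism.

End RTensor.

Definition zero_module (V : zmodType) : Prop := forall x : V, x = 0.

Definition ring_isomorphism (R S : comPzRingType) (f : {rmorphism R -> S}) :
    Prop :=
  exists g : {rmorphism S -> R}, cancel f g /\ cancel g f.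

(* [rtensor_inl] is the canonical map r |-> r ⊗ 1, here from k_A(P). *)
Definition strong_PSI (A B : comPzRingType) (f : {rmorphism A -> B}) : Prop :=
  forall P : Spec A,
    ~ zero_module (rtensor (@to_residue A P) f) ->
    ring_isomorphism (@rtensor_inl A (residue_field P) B (@to_residue A P) f).

Definition idealization (A : comPzRingType) (M : lmodType A) : Type :=
  (A * M)%type.

Section Idealization.
Variables (A : comPzRingType) (M : lmodType A).
Local Notation E := (idealization M).
HB.instance Definition _ := GRing.Zmodule.copy E (A * M)%type.

Definition idz_mul (x y : E) : E := (x.1 * y.1, x.1 *: y.2 + y.1 *: x.2).

Lemma idz_mulA : associative idz_mul.
Proof.
move=> [a m] [b n] [c p]; rewrite /idz_mul /= mulrA; congr pair.
rewrite !scalerDr !scalerA addrA; congr (_ + _ + _); last by rewrite mulrC.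
by rewrite mulrC.
Qed.
Lemma idz_mulC : commutative idz_mul.
Proof. by move=> x y; rewrite /idz_mul mulrC addrC. Qed.
Lemma idz_mul1 : left_id ((1, 0) : E) idz_mul.
Proof.
by move=> [a m]; rewrite /idz_mul /= mul1r scale1r scaler0 addr0.
Qed.
Lemma idz_mulDl : left_distributive idz_mul +%R.
Proof.
move=> [a m] [b n] [c p]; rewrite /idz_mul /= mulrDl; congr pair.
by rewrite scalerDl scalerDr addrACA.
Qed.
HB.instance Definition _ :=
  GRing.Zmodule_isComPzRing.Build E idz_mulA idz_mulC idz_mul1 idz_mulDl.

Definition to_idz (a : A) : E := (a, 0).

Lemma to_idz_zmod_morphism : zmod_morphism to_idz.
Proof. by move=> a b; congr pair; rewrite subr0. Qed.
Lemma to_idz_monoid_morphism : monoid_morphism to_idz.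
Proof. by split=> // a b; congr pair; rewrite !scaler0 addr0. Qed.
HB.instance Definition _ :=
  GRing.isZmodMorphism.Build A E to_idz to_idz_zmod_morphism.
HB.instance Definition _ :=
  GRing.isMonoidMorphism.Build A E to_idz to_idz_monoid_morphism.

End Idealization.

(* Main.v *)
Require Import Defs.
From HB Require Import structures.
From mathcomp Require Import all_boot all_algebra.

(** For every ring morphism [phi : A -> R], the base change of the idealization
    splits as an [R]-module, [R ⊗ A(+)M = R ⊕ (R ⊗ M)]: the tensor product
    commutes with the direct sum [A ⊕ M], and [R ⊗ A = R].  The canonical ring
    map [R -> R ⊗ A(+)M] is the inclusion of the first summand, so it is an
    isomorphism exactly when the second summand vanishes
    ([rtensor_inl_to_idz_isoP]).  It also has a retraction, hence
    [R ⊗ A(+)M] is nonzero as soon as [R] is ([rtensor_to_idz_neq0]).  For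
    [R = k_A(P)], a field, the nonvanishing condition in the definition of a
    strong PSI-morphism thus holds at every prime [P], and what remains of that
    definition is [k_A(P) ⊗ M = 0] for all [P]. *)

Set Implicit Arguments.
Unset Strict Implicit.
Unset Printing Implicit Defensive.

Import GRing.Theory.
Local Open Scope ring_scope.

(** The inverse of a bijective ring morphism is automatically one, so only the
    underlying map has to be exhibited. *)
Lemma can2_ring_isomorphism (R S : comPzRingType) (f : {rmorphism R -> S})
    (g : S -> R) : cancel f g -> cancel g f -> ring_isomorphism f.
Proof.
move=> fK gK.
pose gA := GRing.isZmodMorphism.Build S R g (can2_zmod_morphism fK gK).
pose gM := GRing.isMonoidMorphism.Build S R g (can2_monoid_morphism fK gK).
pose g' : {rmorphism S -> R} := HB.pack g gA gM.
by exists g'.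
Qed.

Section IdealizationBaseChange.
Variables (A R : comPzRingType) (phi : {rmorphism A -> R}) (M : lmodType A).

Local Notation T := (rtensor phi (@to_idz A M)).
Local Notation N := (tensor (restr phi) M).
Local Notation inl := (@rtensor_inl A R (idealization M) phi (@to_idz A M)).

Lemma to_idz_scaleE (a : A) (e : restr (@to_idz A M)) :
  a *: e = (a * e.1, a *: e.2) :> idealization M.
Proof. by congr pair; rewrite /= scaler0 addr0. Qed.

(** The four maps of the biproduct [T = R ⊕ N] are [rtensor_inl] and the three
    below. *)
Definition idz_fst : T -> R :=
  tensor_lift (fun (r : restr phi) (e : restr (@to_idz A M)) =>
                 (r : R) * phi e.1).

Definition idz_snd : T -> N :=
  tensor_lift (fun (r : restr phi) (e : restr (@to_idz A M)) => tens r e.2).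

Definition idz_inr : N -> T :=
  tensor_lift (fun (r : restr phi) (m : M) =>
                 tens r ((0, m) : restr (@to_idz A M))).

Let fstDl (r r' : restr phi) (e : restr (@to_idz A M)) :
  ((r + r' : restr phi) : R) * phi e.1 = (r : R) * phi e.1 + (r' : R) * phi e.1.
Proof. exact: mulrDl. Qed.

Let fstDr (r : restr phi) (e e' : restr (@to_idz A M)) :
  (r : R) * phi (e + e').1 = (r : R) * phi e.1 + (r : R) * phi e'.1.
Proof. by rewrite [phi _]rmorphD mulrDr. Qed.

Let fst_bal a (r : restr phi) (e : restr (@to_idz A M)) :
  ((a *: r : restr phi) : R) * phi e.1 = (r : R) * phi (a *: e).1.
Proof. by rewrite to_idz_scaleE rmorphM [RHS]mulrCA [RHS]mulrA. Qed.

Lemma idz_fst_tens (r : restr phi) (e : restr (@to_idz A M)) :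
  idz_fst (tens r e) = (r : R) * phi e.1.
Proof. exact: (tensor_lift_tens fstDl fstDr fst_bal). Qed.

Lemma idz_fstD : {morph idz_fst : x y / x + y}.
Proof. exact: (tensor_liftD fstDl fstDr fst_bal). Qed.

Let sndDl (r r' : restr phi) (e : restr (@to_idz A M)) :
  tens (r + r') e.2 = tens r e.2 + tens r' e.2.
Proof. exact: tensDl. Qed.

Let sndDr (r : restr phi) (e e' : restr (@to_idz A M)) :
  tens r (e + e').2 = tens r e.2 + tens r e'.2.
Proof. exact: tensDr. Qed.

Let snd_bal a (r : restr phi) (e : restr (@to_idz A M)) :
  tens (a *: r) e.2 = tens r (a *: e).2.
Proof. by rewrite to_idz_scaleE tens_bal. Qed.

Lemma idz_snd_tens (r : restr phi) (e : restr (@to_idz A M)) :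
  idz_snd (tens r e) = tens r e.2.
Proof. exact: (tensor_lift_tens sndDl sndDr snd_bal). Qed.

Lemma idz_sndD : {morph idz_snd : x y / x + y}.
Proof. exact: (tensor_liftD sndDl sndDr snd_bal). Qed.

Let inrDl (r r' : restr phi) (m : M) :
  tens (r + r') ((0, m) : restr (@to_idz A M)) =
  tens r ((0, m) : restr (@to_idz A M)) + tens r' ((0, m) : restr (@to_idz A M)).
Proof. exact: tensDl. Qed.

Let inrDr (r : restr phi) (m m' : M) :
  tens r ((0, m + m') : restr (@to_idz A M)) =
  tens r ((0, m) : restr (@to_idz A M)) + tens r ((0, m') : restr (@to_idz A M)).
Proof. by rewrite -tensDr; congr tens; congr pair; rewrite /= addr0. Qed.

Let inr_bal a (r : restr phi) (m : M) :
  tens (a *: r) ((0, m) : restr (@to_idz A M)) =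
  tens r ((0, a *: m) : restr (@to_idz A M)).
Proof. by rewrite tens_bal to_idz_scaleE /= mulr0. Qed.

Lemma idz_inr_tens (r : restr phi) (m : M) :
  idz_inr (tens r m) = tens r ((0, m) : restr (@to_idz A M)).
Proof. exact: (tensor_lift_tens inrDl inrDr inr_bal). Qed.

Lemma idz_inrD : {morph idz_inr : x y / x + y}.
Proof. exact: (tensor_liftD inrDl inrDr inr_bal). Qed.

Lemma idz_fst0 : idz_fst 0 = 0.
Proof. exact: (tensor_lift0 fstDl fstDr fst_bal). Qed.

Lemma idz_snd0 : idz_snd 0 = 0.
Proof. exact: (tensor_lift0 sndDl sndDr snd_bal). Qed.

Lemma idz_inr0 : idz_inr 0 = 0.
Proof. exact: (tensor_lift0 inrDl inrDr inr_bal). Qed.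

Lemma idz_inlK : cancel inl idz_fst.
Proof. by move=> r; rewrite [LHS]idz_fst_tens rmorph1 mulr1. Qed.

Lemma idz_inrK : cancel idz_inr idz_snd.
Proof.
elim/tensor_ind=> [|x y hx hy|r m]; first by rewrite idz_inr0 idz_snd0.
  by rewrite idz_inrD idz_sndD hx hy.
by rewrite idz_inr_tens idz_snd_tens.
Qed.

Lemma idz_snd_inl r : idz_snd (inl r) = 0.
Proof.
rewrite [LHS]idz_snd_tens /=.
by apply: (addrI (tens (r : restr phi) (0 : M))); rewrite -tensDr !addr0.
Qed.

(** On a pure tensor this is [r ⊗ (a, m) = a r ⊗ (1, 0) + r ⊗ (0, m)]: the
    scalar [a] moves across the tensor sign. *)
Lemma idz_decomp (x : T) : inl (idz_fst x) + idz_inr (idz_snd x) = x.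
Proof.
elim/tensor_ind: x => [|x y hx hy|r [a m]].
- by rewrite idz_fst0 idz_snd0 idz_inr0 rmorph0 addr0.
- by rewrite idz_fstD idz_sndD idz_inrD rmorphD addrACA hx hy.
rewrite idz_fst_tens idz_snd_tens idz_inr_tens /rtensor_inl /rtens /=.
have -> : (r : R) * phi a = (a *: r : restr phi) :> R by rewrite mulrC.
rewrite tens_bal to_idz_scaleE -tensDr /= mulr1 scaler0.
by congr tens; congr pair; rewrite /= ?addr0 ?add0r.
Qed.

Lemma rtensor_inl_to_idz_isoP : ring_isomorphism inl <-> zero_module N.
Proof.
split=> [[g [_ gK]] y|N0].
  by rewrite -[y]idz_inrK -[idz_inr y]gK idz_snd_inl.
apply: (can2_ring_isomorphism idz_inlK) => x.
by rewrite -[RHS]idz_decomp [idz_snd x]N0 idz_inr0 addr0.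
Qed.

Lemma rtensor_to_idz_neq0 : (1 : R) != 0 -> ~ zero_module T.
Proof.
by move=> /eqP R1 T0; apply: R1; rewrite -[1]idz_inlK [inl _]T0 idz_fst0.
Qed.

End IdealizationBaseChange.

Theorem proposition3p5 (A : comPzRingType) (M : lmodType A) :
  strong_PSI (@to_idz A M) <->
  (forall P : Spec A, zero_module (tensor (restr (@to_residue A P)) M)).
Proof.
split=> [psi P|kM0 P _]; last exact/rtensor_inl_to_idz_isoP/kM0.
apply/rtensor_inl_to_idz_isoP; apply: psi.
exact/rtensor_to_idz_neq0/oner_neq0.
Qed.
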